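(* Let $\mathbb{N}=\{1,2,\dots\}$ and $c\in(0,\infty)$. Let $a,b$ be real sequences on $\mathbb{N}$ and $F:\mathbb{R}\to\mathbb{R}$ a function such that: (i) $a_k>0$ for $k\in\mathbb{N}$ and $\sum_{j=1}^{\infty}\frac1{a_j}<\infty$; (ii) $b_k\ge 0$ for $k\in\mathbb{N}$ and $\sum_{j=1}^{\infty}b_j\sum_{i=j}^{\infty}\frac1{a_i}<\infty$; (iii) $F$ is continuous on $\mathbb{R}$, $F(u)u>0$ for $u\neq0$, and the limit $\lim_{u\to0+}\frac{F(u)}{u}$ exists and is finite. Put $L_c=\sup_{u\in(0,c]}\frac{F(u)}{u}$. If there exists $\lambda>0$ such that $$a_k\ge4\lambda(k+1)^2,\qquad\sqrt{1+c^2}\,L_c\,b_k\le\lambda\qquad\text{for all }k\ge1,$$ then the boundary value problem $$\Delta\left(a_k\frac{\Delta x_k}{\sqrt{1+(\Delta x_k)^2}}\right)+b_kF(x_{k+1})=0,\quad k\ge1,$$ $$x_1=c,\quad x_k>0,\quad\Delta x_k\le0\ \ (k\ge1),\quad\lim_{k\to\infty}x_k=0,$$ has at least one solution.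
   Context: $\Delta x_k=x_{k+1}-x_k$. A solution is a real sequence on $\mathbb{N}$ satisfying the equation and all the listed conditions. *)

(* Defs.v *)
From mathcomp Require Import all_boot all_order all_algebra.
From mathcomp Require Import all_classical all_reals all_analysis.

Set Implicit Arguments.
Unset Strict Implicit.
Unset Printing Implicit Defensive.

Import Order.TTheory GRing.Theory Num.Theory.
Import numFieldNormedType.Exports.

Local Open Scope classical_set_scope.
Local Open Scope ring_scope.

(* A sequence indexed by {1, 2, ...} is represented by a function on nat whose
   value at 0 is irrelevant: every condition is
   restricted to indices k >= 1. *)

Definition fdiff (R : realType) (x : nat -> R) (k : nat) : R := x k.+1 - x k.

Definition bvp_solution (R : realType) (a b : nat -> R) (F : R -> R) (c : R)
    (x : nat -> R) : Prop :=
  [/\ forall k, (1 <= k)%N ->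
        fdiff (fun j => a j * (fdiff x j / Num.sqrt (1 + fdiff x j ^+ 2))) k
        + b k * F (x k.+1) = 0,
      x 1%N = c,
      forall k, (1 <= k)%N -> 0 < x k,
      forall k, (1 <= k)%N -> fdiff x k <= 0
    & x k @[k --> \oo] --> (0 : R)].

(* The real-valued sup is a junk value on unbounded sets; here the set is
   bounded whenever F is continuous and F u / u has a finite limit at 0+. *)
Definition sup_ratio (R : realType) (F : R -> R) (c : R) : R :=
  sup [set F u / u | u in [set u : R | 0 < u <= c]].

(* Main.v *)
Require Import Defs.
From mathcomp Require Import all_boot all_order all_algebra.
From mathcomp Require Import all_classical all_reals all_analysis.
From mathcomp Require Import lra.

Import Order.TTheory GRing.Theory Num.Theory.
Import numFieldNormedType.Exports.

Local Open Scope classical_set_scope.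
Local Open Scope ring_scope.

(** The solution is found by shooting on the initial flux.  Write
    w_k = - a_k Dx_k / sqrt (1 + (Dx_k)^2).  The equation says that w_k
    increases by b_k F (x_{k+1}), while x_k decreases by the inverse of
    y |-> y / sqrt (1 + y^2) at w_k / a_k.  Two modifications make the
    recursion a family of globally defined continuous maps: F is replaced by
    its positive part, and the inverse z / sqrt (1 - z^2) by [trunc_slope],
    which agrees with it at every z >= 0 where its value is at most c.  As
    long as the heights stay in [0, c] the drops are at most c, so such a
    trajectory solves the original equation.  Moreover, whatever s = w_1 >= 0 is, the
    fluxes increase and the heights decrease.

    Let t be the infimum of the s >= 0 whose trajectory becomes negative
    ([shooting_principle]).  Negativity at a given index is an open condition,
    and s = 0 does not have it, so the trajectory of t is nonnegative; it is
    then positive and decreases to a limit l.  If l > 0, every s slightly above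
    t would also stay positive: up to a large index N by continuity, and
    beyond N because the drops are dominated, uniformly in s near t, by a
    summable sequence.  This contradicts the choice of t.  The domination is
    where the two summability hypotheses enter ([flux_bound_summable]): fluxes
    are bounded by A + B (b_1 + ... + b_{k-1}), and exchanging the order of
    summation in the sum of these bounds over a_k gives the hypothesis on
    sum_j b_j sum_{i >= j} 1 / a_i.

    That s = 0 stays positive is a discrete form of Hardy's inequality
    ([riccati_invariant]).  With K = sqrt (1 + c^2), the secant bound
    [trunc_slope] z <= K z and F u <= L_c u compare the recursion with
    4 lambda D((k+1)^2 Dx_k) + lambda x_{k+1} = 0, the critical
    nonoscillatory Euler equation; its continuous counterpart has the solution
    u = t^(-1/2), with flux equal to 2 lambda t u.  This suggests the invariant
    K w_k <= 2 lambda k x_k, which is indeed preserved. *)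

(** * The shooting method for a system of two recursions *)

(** The pair of height and flux at stage n, with c and s as initial values.  The
    flux is updated with the new height because F is evaluated at x_{k+1}. *)
Fixpoint shoot {R : realType} (step load : nat -> R -> R) (c s : R) (n : nat)
    : R * R :=
  if n is m.+1 then
    let p := shoot step load c s m in
    let x := p.1 - step m p.2 in (x, p.2 + load m x)
  else (c, s).

Lemma shoot_continuous (R : realType) (step load : nat -> R -> R) (c : R) n :
  (forall n, continuous (step n)) -> (forall n, continuous (load n)) ->
  continuous (fun s => (shoot step load c s n).1) /\
  continuous (fun s => (shoot step load c s n).2).
Proof.
move=> step_cont load_cont; elim: n => [|n [IHx IHw]] /=.
  by split=> s; [exact: cvg_cst | exact: cvg_id].
have xS_cont : continuous (fun s =>
    (shoot step load c s n).1 - step n (shoot step load c s n).2).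
  move=> s; apply: cvgB; first exact: IHx.
  exact: continuous_comp (IHw s) (step_cont n _).
split=> // s; apply: cvgD; first exact: IHw.
exact: continuous_comp (xS_cont s) (load_cont n _).
Qed.

Lemma shoot_flux_homo (R : realType) (step load : nat -> R -> R) (c s : R) :
  (forall n u, 0 <= load n u) ->
  {homo (fun n => (shoot step load c s n).2) : m n / (m <= n)%N >-> m <= n}.
Proof.
by move=> load_ge0; apply/nondecreasing_seqP => n /=; rewrite lerDl.
Qed.

Lemma shoot_height_homo (R : realType) (step load : nat -> R -> R) (c s : R) :
  (forall n w, 0 <= w -> 0 <= step n w) -> (forall n u, 0 <= load n u) ->
  0 <= s ->
  {homo (fun n => (shoot step load c s n).1) : m n / (m <= n)%N >-> n <= m}.
Proof.
move=> step_ge0 load_ge0 s_ge0; apply/nonincreasing_seqP => n /=.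
rewrite gerBl step_ge0 //; apply: le_trans s_ge0 _.
exact: (shoot_flux_homo R step load c s load_ge0 0 n).
Qed.

(** If the height vanishes at stage n, the next drop must be zero, hence so is
    the flux at n; by monotonicity all earlier fluxes vanish as well, and the
    height has never moved from c. *)
Lemma shoot_height_gt0 (R : realType) (step load : nat -> R -> R) (c s : R) :
  0 < c -> 0 <= s ->
  (forall n w, 0 <= w -> 0 <= step n w) -> (forall n u, 0 <= load n u) ->
  (forall n, step n 0 = 0) -> (forall n w, 0 < w -> 0 < step n w) ->
  (forall n, 0 <= (shoot step load c s n).1) ->
  forall n, 0 < (shoot step load c s n).1.
Proof.
move=> c_gt0 s_ge0 step_ge0 load_ge0 step0 step_gt0 x_ge0 n.
have w_homo := shoot_flux_homo R step load c s load_ge0.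
have w_ge0 m : 0 <= (shoot step load c s m).2 by apply: le_trans (w_homo 0 m _).
rewrite lt_neqAle x_ge0 andbT eq_sym; apply/eqP => xn0.
have wn0 : (shoot step load c s n).2 = 0.
  have := x_ge0 n.+1; rewrite /= xn0 sub0r oppr_ge0 => step_le0.
  apply/eqP; case: (eqVneq _ 0) => // w_neq0; move: step_le0.
  by rewrite leNgt step_gt0 // lt_neqAle eq_sym w_neq0 w_ge0.
suff: (shoot step load c s n).1 = c by move: c_gt0 => /[swap]; rewrite xn0 => ->; rewrite ltxx.
have: forall m, (m <= n)%N -> (shoot step load c s m).1 = c.
  elim=> [//|m IH ltmn] /=; rewrite IH 1?ltnW //.
  suff -> : (shoot step load c s m).2 = 0 by rewrite step0 subr0.
  by apply/eqP; rewrite eq_le w_ge0 -{1}wn0 w_homo // ltnW.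
exact.
Qed.

Lemma series_tail_lt (R : realType) (E : nat -> R) (e : R) :
  (forall n, 0 <= E n) -> cvgn (series E) -> 0 < e ->
  exists N, forall m, (N <= m)%N -> \sum_(N <= k < m) E k < e.
Proof.
move=> E_ge0 E_cvg e_gt0.
have E_homo : {homo series E : m n / (m <= n)%N >-> m <= n}.
  apply/nondecreasing_seqP => n.
  by rewrite /series /= big_nat_recr //= lerDl.
have : \forall n \near \oo, limn (series E) - e < series E n.
  by apply: cvgr_gt E_cvg _ _; rewrite gtrBl.
case=> N _ HN; exists N => m leNm.
have lim_lt : limn (series E) - e < series E N := HN N (leqnn N).
have lim_ge : series E m <= limn (series E) := nondecreasing_cvgn_le E_homo E_cvg m.
have -> : \sum_(N <= k < m) E k = series E m - series E N.
  by rewrite sub_series leNm.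
lra.
Qed.

(** The threshold between the initial fluxes that overshoot 0 and those that do
    not is attained by a trajectory decreasing exactly to 0.  The domination
    hypothesis is stated on each interval [0, S] because the threshold is
    approached from above, by initial fluxes slightly larger than it. *)
Lemma shooting_principle (R : realType) (step load : nat -> R -> R)
    (c s1 : R) (m1 : nat) :
  0 < c -> 0 <= s1 ->
  (forall n, continuous (step n)) -> (forall n, continuous (load n)) ->
  (forall n u, 0 <= load n u) ->
  (forall n, step n 0 = 0) -> (forall n w, 0 < w -> 0 < step n w) ->
  (forall n, 0 <= (shoot step load c 0 n).1) ->
  (shoot step load c s1 m1).1 < 0 ->
  (forall S, exists2 E : nat -> R, cvgn (series E) &
     forall s n, 0 <= s <= S -> step n (shoot step load c s n).2 <= E n) ->
  exists2 s, 0 <= s &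
    (forall n, 0 < (shoot step load c s n).1) /\
    (shoot step load c s n).1 @[n --> \oo] --> (0 : R).
Proof.
move=> c_gt0 s1_ge0 step_cont load_cont load_ge0 step0 step_gt0 x0_ge0 x1_lt0 tail.
have step_ge0 n w : 0 <= w -> 0 <= step n w.
  by rewrite le_eqVlt => /predU1P[<-|/step_gt0/ltW//]; rewrite step0.
pose P := [set s : R | 0 <= s /\ exists n, (shoot step load c s n).1 < 0].
have P_lb : lbound P 0 by move=> s [].
have P_inf : has_inf P by split; [exists s1; split=> //; exists m1 | exists 0].
have P_glb s : P s -> inf P <= s by apply: ge_inf; exists 0.
set t := inf P.
have t_ge0 : 0 <= t by apply: lb_le_inf P_lb; case: P_inf.
have x_cont n : continuous (fun s => (shoot step load c s n).1).
  by have [] := shoot_continuous R step load c n step_cont load_cont.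
have xt_ge0 n : 0 <= (shoot step load c t n).1.
  rewrite leNgt; apply/negP => xn_lt0.
  (* Overshooting at t would propagate to smaller initial fluxes. *)
  have t_gt0 : 0 < t.
    rewrite lt_neqAle t_ge0 andbT; apply/eqP => t0.
    by move: xn_lt0; rewrite -t0 ltNge x0_ge0.
  have : \forall s \near t, (shoot step load c s n).1 < 0.
    exact: (cvgr_lt _ (x_cont n t) _ xn_lt0).
  move=> /nbhs_ballP[e /= e_gt0 He].
  pose s := t - Num.min (e / 2) (t / 2).
  have m_gt0 : 0 < Num.min (e / 2) (t / 2) by rewrite lt_min !divr_gt0.
  have : t <= s.
    apply: P_glb; split.
      rewrite subr_ge0 ge_min; apply/orP; right; lra.
    exists n; apply: He; rewrite /ball /= /s opprB addrC subrK gtr0_norm //.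
    rewrite gt_min; apply/orP; left; lra.
  rewrite /s; lra.
have x_homo s : 0 <= s ->
    {homo (fun n => (shoot step load c s n).1) : m n / (m <= n)%N >-> n <= m}.
  exact: shoot_height_homo.
have x_cvg : cvgn (fun n => (shoot step load c t n).1).
  apply: nonincreasing_is_cvgn; first exact: x_homo.
  by exists 0 => _ [n _ <-].
set l := limn (fun n => (shoot step load c t n).1).
have l_ge0 : 0 <= l.
  apply: limr_ge; first exact: x_cvg.
  by apply: nearW => n; exact: xt_ge0.
have l_le n : l <= (shoot step load c t n).1.
  by apply: (nonincreasing_cvgn_ge (x_homo t t_ge0)).
exists t => //; split; first exact: shoot_height_gt0.
suff l0 : l = 0 by rewrite -l0; exact: x_cvg.
apply/eqP; rewrite eq_le l_ge0 andbT leNgt; apply/negP => l_gt0.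
(* A positive limit would leave a margin l / 2 below the trajectory of t:
   drops beyond N fit in it, so no s in [t, t + d) overshoots. *)
have [E E_cvg stepE] := tail (t + 1).
have w_ge0 s n : 0 <= s -> 0 <= (shoot step load c s n).2.
  by move=> s_ge0; apply: le_trans (shoot_flux_homo R step load c s load_ge0 0 n _).
have E_ge0 n : 0 <= E n.
  apply: le_trans (stepE t n _); first by rewrite step_ge0 ?w_ge0.
  by rewrite t_ge0 lerDl ler01.
have l2_gt0 : 0 < l / 2 by rewrite divr_gt0.
have [N tailN] := series_tail_lt R E (l / 2) E_ge0 E_cvg l2_gt0.
have : \forall s \near t, l / 2 < (shoot step load c s N).1.
  apply: (cvgr_gt _ (x_cont N t)).
  by apply: lt_le_trans (l_le N); lra.
move=> /nbhs_ballP[e /= e_gt0 He].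
pose d := Num.min e 1.
have d_gt0 : 0 < d by rewrite lt_min e_gt0 ltr01.
have [s [s_ge0 [n xn_lt0]] s_lt] := inf_adherent d_gt0 P_inf.
have t_le : t <= s by apply: P_glb; split=> //; exists n.
have d_le1 : d <= 1 by rewrite ge_min lexx orbT.
have d_lee : d <= e by rewrite ge_min lexx.
have xN_gt : l / 2 < (shoot step load c s N).1.
  apply: He; rewrite /ball /= distrC ger0_norm ?subr_ge0 //.
  by rewrite ltrBlDl; apply: lt_le_trans s_lt _; rewrite lerD2l.
have x_ge m : (N <= m)%N ->
    (shoot step load c s N).1 - \sum_(N <= k < m) E k
      <= (shoot step load c s m).1.
  elim: m => [|m IH]; first by rewrite leqn0 => /eqP ->; rewrite big_geq ?subr0.
  rewrite leq_eqVlt => /predU1P[<-|]; first by rewrite big_geq ?subr0.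
  rewrite ltnS => leNm; rewrite big_nat_recr //=.
  have sE : step m (shoot step load c s m).2 <= E m.
    apply: stepE; rewrite s_ge0 /=.
    by apply: le_trans (ltW s_lt) _; rewrite lerD2l.
  have := IH leNm; lra.
have lem : (N <= maxn N n)%N by rewrite leq_maxl.
have := x_ge _ lem; have := tailN _ lem.
have := x_homo s s_ge0 n (maxn N n) (leq_maxr _ _).
lra.
Qed.

(** * Nonoscillation by a discrete Riccati bound *)

(** The quotient K w / x of flux by height is a discrete Riccati variable, and
    2 lambda (n+1) is a supersolution of its recursion: one step amounts to
    (2k + 1) (1 - k / (2 (k+1)^2)) >= 2k with k = n + 1, that is, to
    k (2k + 1) <= 2 (k + 1)^2.  The bound on the quotient makes each drop
    smaller than the current height, which keeps the height positive. *)
Lemma riccati_invariant (R : realType) (step load : nat -> R -> R)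
    (a : nat -> R) (c s K lambda : R) :
  0 < c -> 0 <= s -> 0 < lambda -> 0 < K ->
  (forall n w, 0 <= w -> 0 <= step n w) -> (forall n u, 0 <= load n u) ->
  (forall n w, 0 <= w -> step n w <= K * (w / a n)) ->
  (forall n, 4 * lambda * n.+2%:R ^+ 2 <= a n) ->
  (forall n u, 0 < u <= c -> K * load n u <= lambda * u) ->
  K * s <= 2 * lambda * c ->
  forall n, 0 < (shoot step load c s n).1 /\
    K * (shoot step load c s n).2
      <= 2 * lambda * n.+1%:R * (shoot step load c s n).1.
Proof.
move=> c_gt0 s_ge0 lambda_gt0 K_gt0 step_ge0 load_ge0 step_le a_ge load_le s_le.
elim=> [|n [x_gt0 v_le]]; first by rewrite mulr1.
have w_ge0 : 0 <= (shoot step load c s n).2.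
  by apply: le_trans s_ge0 _; exact: (shoot_flux_homo R step load c s load_ge0 0 n).
have xS_lec : (shoot step load c s n.+1).1 <= c.
  exact: (shoot_height_homo R step load c s step_ge0 load_ge0 s_ge0 0 n.+1).
move: xS_lec => /=.
set x := (shoot _ _ _ _ n).1 in x_gt0 v_le *.
set w := (shoot _ _ _ _ n).2 in v_le w_ge0 *.
set x' := x - step n w => x'_lec.
have [q_ge k_ge0] : (1 <= n.+1%:R :> R) /\ n.+2%:R = n.+1%:R + 1 :> R.
  by rewrite ler1n -[n.+2%:R]natr1.
have a_gt0 : 0 < a n.
  apply: lt_le_trans (a_ge n); rewrite k_ge0.
  by rewrite mulr_gt0 ?mulr_gt0 ?exprn_gt0 //; lra.
set k : R := n.+1%:R in v_le q_ge k_ge0 *.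
have a_gek := a_ge n; rewrite k_ge0 in a_gek.
have step_lek : 2 * (k + 1) ^+ 2 * step n w <= k * x.
  have h1 : step n w * a n <= K * w.
    by rewrite -ler_pdivlMr // -mulrA; exact: step_le.
  have h2 : step n w * (4 * lambda * (k + 1) ^+ 2) <= step n w * a n.
    by rewrite ler_wpM2l ?step_ge0.
  have h3 := le_trans h2 (le_trans h1 v_le).
  rewrite -(ler_pM2l (mulr_gt0 (ltr0n R 2) lambda_gt0)); lra.
have k2_gt0 : 0 < 2 * (k + 1) ^+ 2 by rewrite mulr_gt0 ?exprn_gt0; lra.
have x'_ge : 2 * k * x <= (2 * k + 1) * x'.
  rewrite -(ler_pM2l k2_gt0) /x'.
  have : (2 * k + 1) * (2 * (k + 1) ^+ 2 * step n w) <= (2 * k + 1) * (k * x).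
    by rewrite ler_wpM2l //; lra.
  have : 0 <= (3 * k + 2) * x by rewrite mulr_ge0 ?ltW //; lra.
  lra.
have x'_gt0 : 0 < x'.
  have k_gt0 : 0 < 2 * k + 1 by lra.
  rewrite -(pmulr_rgt0 _ k_gt0); apply: lt_le_trans x'_ge.
  by rewrite !mulr_gt0 //; lra.
split=> //; rewrite mulrDr k_ge0.
have l_le : K * load n x' <= lambda * x' by apply: load_le; rewrite x'_gt0.
have : lambda * (2 * k * x) <= lambda * ((2 * k + 1) * x').
  by apply: ler_wpM2l => //; exact: ltW.
lra.
Qed.

(** * Inverting the flux *)

(** The inverse z / sqrt (1 - z^2) of y |-> y / sqrt (1 + y^2), continued
    linearly for |z| >= c / sqrt (1 + c^2), where its absolute value is >= c.  Capping
    the denominator from below gives a function continuous on the whole line,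
    including where 1 - z^2 is negative and its square root is 0. *)
Definition trunc_slope {R : realType} (c z : R) : R :=
  z / Num.max (Num.sqrt (1 - z ^+ 2)) (Num.sqrt (1 + c ^+ 2))^-1.

Lemma sqrt1D_ge1 (R : realType) (c : R) : 1 <= Num.sqrt (1 + c ^+ 2).
Proof. by rewrite -{1}(sqrtr1 R) ler_wsqrtr // lerDl sqr_ge0. Qed.

Lemma trunc_denom_gt0 (R : realType) (c z : R) :
  0 < Num.max (Num.sqrt (1 - z ^+ 2)) (Num.sqrt (1 + c ^+ 2))^-1.
Proof.
rewrite lt_max invr_gt0 (lt_le_trans _ (sqrt1D_ge1 R c)) ?orbT //.
Qed.

Lemma trunc_slope_continuous (R : realType) (c : R) :
  continuous (trunc_slope c).
Proof.
move=> z; rewrite /trunc_slope.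
apply: cvgM; first exact: cvg_id.
apply: cvgV; first by rewrite gt_eqF ?trunc_denom_gt0.
apply: (@continuous_max R R (fun z : R => Num.sqrt (1 - z ^+ 2))
  (fun=> (Num.sqrt (1 + c ^+ 2))^-1)); last exact: cvg_cst.
apply: (@continuous_comp _ _ _ (fun z : R => 1 - z ^+ 2)).
  by apply: cvgB; [exact: cvg_cst | exact: exprn_continuous].
exact: sqrt_continuous.
Qed.

Lemma trunc_slope0 (R : realType) (c : R) : trunc_slope c 0 = 0.
Proof. by rewrite /trunc_slope mul0r. Qed.

Lemma trunc_slope_gt0 (R : realType) (c z : R) : 0 < z -> 0 < trunc_slope c z.
Proof. by move=> z_gt0; rewrite divr_gt0 ?trunc_denom_gt0. Qed.

Lemma trunc_slope_ge (R : realType) (c z : R) : 0 <= z -> z <= trunc_slope c z.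
Proof.
move=> z_ge0; rewrite ler_pdivlMr ?trunc_denom_gt0 // ler_piMr //.
rewrite ge_max invf_le1 ?(lt_le_trans _ (sqrt1D_ge1 R c)) // sqrt1D_ge1 andbT.
by rewrite -{2}(sqrtr1 R) ler_wsqrtr // gerBl sqr_ge0.
Qed.

Lemma trunc_slope_le (R : realType) (c z : R) :
  0 <= z -> trunc_slope c z <= Num.sqrt (1 + c ^+ 2) * z.
Proof.
move=> z_ge0; have K_gt0 := lt_le_trans ltr01 (sqrt1D_ge1 R c).
rewrite mulrC ler_wpM2l // -[leRHS]invrK lef_pV2 ?posrE ?invr_gt0 ?trunc_denom_gt0 //.
by rewrite le_max lexx orbT.
Qed.

(** A slope of at most c comes from the part where the truncation is inactive. *)
Lemma trunc_slopeK (R : realType) (c z : R) :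
  0 < c -> 0 <= z -> trunc_slope c z <= c ->
  trunc_slope c z / Num.sqrt (1 + trunc_slope c z ^+ 2) = z.
Proof.
move=> c_gt0 z_ge0 slope_le.
have K_gt0 := lt_le_trans ltr01 (sqrt1D_ge1 R c).
have K2 : Num.sqrt (1 + c ^+ 2) ^+ 2 = 1 + c ^+ 2.
  by rewrite sqr_sqrtr // addr_ge0 ?sqr_ge0.
have D_gt0 := trunc_denom_gt0 R c z.
have max_eq : Num.max (Num.sqrt (1 - z ^+ 2)) (Num.sqrt (1 + c ^+ 2))^-1
    = Num.sqrt (1 - z ^+ 2).
  apply/eqP; rewrite eq_maxl.
  (* On the linear part, a value of at most c forces z <= c / sqrt (1 + c^2),
     which is where the linear part begins. *)
  case: leP => // root_lt.
  move: slope_le; rewrite /trunc_slope (max_r (ltW root_lt)) invrK => zK_le.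
  suff: (Num.sqrt (1 + c ^+ 2))^-1 <= Num.sqrt (1 - z ^+ 2).
    by rewrite leNgt root_lt.
  rewrite -(ler_pM2l K_gt0) mulfV ?gt_eqF // -sqrtrM ?addr_ge0 ?sqr_ge0 //.
  rewrite -{1}(sqrtr1 R) ler_wsqrtr //.
  have : (z * Num.sqrt (1 + c ^+ 2)) ^+ 2 <= c ^+ 2.
    by rewrite lerXn2r ?nnegrE ?(ltW c_gt0) // mulr_ge0 // ltW.
  rewrite exprMn K2; lra.
rewrite max_eq in D_gt0; rewrite /trunc_slope max_eq.
set r := Num.sqrt (1 - z ^+ 2) in D_gt0 *.
have r2 : r ^+ 2 = 1 - z ^+ 2.
  by rewrite sqr_sqrtr // ltW // -sqrtr_gt0.
have -> : 1 + (z / r) ^+ 2 = r^-1 ^+ 2.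
  have -> : 1 = r ^+ 2 * r^-1 ^+ 2 by rewrite -exprMn mulfV ?gt_eqF ?expr1n.
  by rewrite exprMn -mulrDl r2 subrK mul1r.
by rewrite sqrtr_sqr gtr0_norm ?invr_gt0 // mulfK // invr_eq0 gt_eqF.
Qed.

(** * Bounds from the hypotheses *)

(** The supremum is a genuine one: the ratio is bounded near 0 by the existence
    of its limit, and on the remaining compact interval by continuity. *)
Lemma ratio_le_sup (R : realType) (F : R -> R) (c u : R) :
  continuous F -> cvg (F u / u @[u --> 0^'+]) ->
  0 < u <= c -> F u / u <= sup_ratio F c.
Proof.
move=> F_cont F_lim u_in.
apply: ub_le_sup; last by exists u.
have : \forall v \near 0^'+, F v / v < lim (F v / v @[v --> 0^'+]) + 1.
  by apply: (cvgr_lt _ F_lim); rewrite ltrDl.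
move=> /nbhs_right0P/nbhs_ballP[e /= e_gt0 He].
pose d := Num.min (e / 2) c.
have c_gt0 : 0 < c by case/andP: u_in => /lt_le_trans; apply.
have d_gt0 : 0 < d by rewrite lt_min divr_gt0.
have [m _ m_max] : exists2 m, m \in `[d, c] &
    forall t, t \in `[d, c] -> F t / t <= F m / m.
  apply: EVT_max; first by rewrite ge_min lexx orbT.
  apply: continuous_in_subspaceT => t; rewrite inE /= in_itv /= => /andP[dt _].
  apply: continuousM; first exact: F_cont.
  by apply: continuousV; [rewrite gt_eqF // (lt_le_trans d_gt0) | exact: cvg_id].
exists (Num.max (lim (F v / v @[v --> 0^'+]) + 1) (F m / m)).
move=> _ [v /= /andP[v_gt0 v_le] <-]; rewrite le_max.
have [v_ltd|d_lev] := ltP v d; last first.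
  by apply/orP; right; apply: m_max; rewrite in_itv /= d_lev.
apply/orP; left; apply/ltW.
have v_lt2 : v < e / 2 by apply: lt_le_trans v_ltd _; rewrite ge_min lexx.
have := He v; rewrite /ball /= sub0r normrN gtr0_norm // add0r; apply=> //.
lra.
Qed.

Lemma nneseries_bounded (R : realType) (u : nat -> \bar R) :
  (forall k, (1 <= k)%N -> (0 <= u k)%E) ->
  (\sum_(1 <= k <oo) u k < +oo)%E ->
  exists B : R, forall m, (\sum_(1 <= k < m) u k <= B%:E)%E.
Proof.
move=> u_ge0 u_lty.
have sum_ge0 : (0 <= \sum_(1 <= k <oo) u k)%E.
  by apply: nneseries_ge0 => k k1 _; exact: u_ge0.
exists (fine (\sum_(1 <= k <oo) u k)%E) => m.
rewrite fineK ?ge0_fin_numE //.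
by apply: nneseries_lim_ge => k k1 _; exact: u_ge0.
Qed.

(** Exchanging the order of summation turns the sum over k of
    (b_1 + ... + b_{k-1}) / a_k into the sum over j of b_j times a part of the
    tail of the sum of 1 / a_i from j on. *)
Lemma flux_bound_summable (R : realType) (a b : nat -> R) (A B : R) :
  (forall k, (1 <= k)%N -> 0 < a k) -> (forall k, (1 <= k)%N -> 0 <= b k) ->
  (\sum_(1 <= j <oo) ((a j)^-1)%:E < +oo)%E ->
  (\sum_(1 <= j <oo) ((b j)%:E * \sum_(j <= i <oo) ((a i)^-1)%:E) < +oo)%E ->
  0 <= A -> 0 <= B ->
  cvgn (series (fun n => (A + B * \sum_(1 <= j < n.+1) b j) / a n.+1)).
Proof.
move=> a_gt0 b_ge0 sum_a sum_ba A_ge0 B_ge0.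
have aV_ge0 k : (1 <= k)%N -> 0 <= (a k)^-1.
  by move=> k1; rewrite invr_ge0 ltW ?a_gt0.
have tail_ge0 j : (1 <= j)%N -> (0 <= \sum_(j <= i <oo) ((a i)^-1)%:E)%E.
  move=> j1; apply: nneseries_ge0 => i ji _.
  by rewrite lee_fin aV_ge0 // (leq_trans j1).
have [Ba HBa] : exists Ba : R, forall m,
    (\sum_(1 <= j < m) ((a j)^-1)%:E <= Ba%:E)%E.
  by apply: nneseries_bounded => // k k1; rewrite lee_fin aV_ge0.
have [Bb HBb] : exists Bb : R, forall m,
    (\sum_(1 <= j < m) ((b j)%:E * \sum_(j <= i <oo) ((a i)^-1)%:E) <= Bb%:E)%E.
  apply: nneseries_bounded => // k k1.
  by rewrite mule_ge0 ?tail_ge0 // lee_fin b_ge0.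
have dbl m : \sum_(1 <= k < m) (\sum_(1 <= j < k) b j) / a k <= Bb.
  have -> : \sum_(1 <= k < m) (\sum_(1 <= j < k) b j) / a k
      = \sum_(1 <= j < m) b j * \sum_(1 <= k < m | (j < k)%N) (a k)^-1.
    transitivity (\sum_(1 <= k < m) \sum_(1 <= j < m | (j < k)%N) b j / a k).
      apply: eq_big_nat => k /andP[_ km].
      by rewrite (big_nat_widen _ _ m) 1?ltnW // mulr_suml.
    rewrite (exchange_big_dep_nat predT) //=.
    by apply: eq_bigr => j _; rewrite mulr_sumr.
  rewrite -lee_fin; apply: le_trans (HBb m).
  rewrite -sumEFin big_nat_cond [leRHS]big_nat_cond.
  apply: lee_sum => j; rewrite andbT => /andP[j1 jm].
  rewrite EFinM lee_wpmul2l ?lee_fin ?b_ge0 //.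
  apply: (@le_trans _ _ (\sum_(j <= k < m) ((a k)^-1)%:E)%E); last first.
    apply: nneseries_lim_ge => k jk _.
    by rewrite lee_fin aV_ge0 // (leq_trans j1).
  rewrite sumEFin lee_fin (big_nat_widenl j 1) //=.
  rewrite [leLHS]big_mkcond [leRHS]big_mkcond big_nat_cond [leRHS]big_nat_cond.
  apply: ler_sum => k; rewrite andbT => /andP[k1 _].
  case: ltnP => [jk|]; first by rewrite ltnW.
  by case: ifP => // _ _; rewrite aV_ge0.
apply: nondecreasing_is_cvgn.
  apply/nondecreasing_seqP => n.
  rewrite /series /= big_nat_recr //= lerDl divr_ge0 ?(ltW (a_gt0 _ _)) //.
  rewrite addr_ge0 // mulr_ge0 // big_nat_cond sumr_ge0 // => j.
  by rewrite andbT => /andP[j1 _]; exact: b_ge0.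
exists (A * Ba + B * Bb) => _ [n _ <-].
rewrite /series /= -(big_add1 _ _ 0 n.+1 xpredT
  (fun k => (A + B * \sum_(1 <= j < k) b j) / a k)).
under eq_bigr do rewrite mulrDl -mulrA.
rewrite big_split /= -!mulr_sumr.
rewrite lerD // ler_wpM2l //.
by have := HBa n.+1; rewrite sumEFin lee_fin.
Qed.
(** The constant |F 0| + L_c c serves for u <= 0 as well, where F is negative
    except perhaps at 0. *)
Lemma pos_part_bounded (R : realType) (F : R -> R) (c u : R) :
  0 < c -> continuous F -> (forall u, u != 0 -> 0 < F u * u) ->
  cvg (F u / u @[u --> 0^'+]) ->
  u <= c -> Num.max (F u) 0 <= `|F 0| + sup_ratio F c * c.
Proof.
move=> c_gt0 F_cont F_sign F_lim0 u_le.
have L_ge0 : 0 <= sup_ratio F c.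
  apply: le_trans (ratio_le_sup R F c c F_cont F_lim0 _); last by rewrite c_gt0 lexx.
  by have := F_sign c; rewrite gt_eqF // pmulr_lgt0 // => /(_ isT) ?; rewrite divr_ge0 ?ltW.
have Lc_ge0 : 0 <= sup_ratio F c * c by rewrite mulr_ge0 // ltW.
rewrite ge_max addr_ge0 // andbT.
case: (ltrgtP u 0) => [u_lt0|u_gt0|->].
- have := F_sign u; rewrite lt_eqF // nmulr_lgt0 // => /(_ isT) F_lt0.
  by apply: le_trans (ltW F_lt0) _; rewrite addr_ge0.
- have := ratio_le_sup R F c u F_cont F_lim0; rewrite u_gt0 u_le => /(_ isT).
  rewrite ler_pdivrMr // => /le_trans; apply.
  by rewrite -[leLHS]add0r lerD // ler_wpM2l.
- by apply: le_trans (ler_norm _) _; rewrite lerDl.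
Qed.

(** * The boundary value problem *)

(** Along a positive trajectory every drop is at most the current height,
    hence at most c: the truncation of the slope and, the heights being
    positive, that of F are both inactive. *)
Lemma shoot_bvp_solution (R : realType) (a b : nat -> R) (F : R -> R) (c s : R) :
  0 < c -> 0 <= s ->
  (forall k, (1 <= k)%N -> 0 < a k) -> (forall k, (1 <= k)%N -> 0 <= b k) ->
  (forall u, u != 0 -> 0 < F u * u) ->
  let traj := shoot (fun n w => trunc_slope c (w / a n.+1))
                (fun n u => b n.+1 * Num.max (F u) 0) c s in
  (forall n, 0 < (traj n).1) -> (traj n).1 @[n --> \oo] --> (0 : R) ->
  bvp_solution a b F c (fun k => (traj k.-1).1).
Proof.
move=> c_gt0 s_ge0 a_gt0 b_ge0 F_sign; set step := fun _ _ => trunc_slope _ _.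
set load := fun _ _ => _ * Num.max _ _; move=> traj x_gt0 x_lim.
have load_ge0 n u : 0 <= load n u by rewrite mulr_ge0 ?b_ge0 // le_max lexx orbT.
have step_ge0 n w : 0 <= w -> 0 <= step n w.
  move=> w_ge0; have z_ge0 : 0 <= w / a n.+1 by rewrite divr_ge0 // ltW ?a_gt0.
  exact: le_trans (trunc_slope_ge R c _ z_ge0).
have w_ge0 n : 0 <= (traj n).2.
  exact: le_trans s_ge0 (shoot_flux_homo R step load c s load_ge0 0 n isT).
have drop n : fdiff (fun k => (traj k.-1).1) n.+1 = - step n (traj n).2.
  by rewrite /fdiff /= addrAC subrr add0r.
have flux n : a n.+1 * (fdiff (fun k => (traj k.-1).1) n.+1 /
    Num.sqrt (1 + fdiff (fun k => (traj k.-1).1) n.+1 ^+ 2)) = - (traj n).2.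
  have z_ge0 : 0 <= (traj n).2 / a n.+1 by rewrite divr_ge0 // ltW ?a_gt0.
  rewrite drop sqrrN mulNr /step trunc_slopeK //.
    by rewrite mulrN mulrC divfK // gt_eqF ?a_gt0.
  have xn_le : (traj n).1 <= c.
    exact: (shoot_height_homo R step load c s step_ge0 load_ge0 s_ge0 0 n).
  apply: le_trans xn_le; rewrite -subr_ge0.
  exact: ltW (x_gt0 n.+1).
split=> //.
- case=> // n _; rewrite {1}/fdiff !flux /= -/load.
  have F_gt0 : 0 < F (traj n.+1).1.
    by rewrite -(pmulr_lgt0 _ (x_gt0 n.+1)) F_sign // gt_eqF.
  have -> : load n ((traj n).1 - step n (traj n).2) = b n.+1 * F (traj n.+1).1.
    by rewrite /load -/(traj n.+1).1 max_l // ltW.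
  by rewrite opprK opprD /=; lra.
- by case=> // n _; rewrite drop oppr_le0 step_ge0.
- apply/cvgrPdist_lt => e e_gt0; move/cvgrPdist_lt: x_lim => /(_ e e_gt0)[N _ HN].
  by exists N.+1 => // -[//|k] /= Nk; apply: HN.
Qed.

Theorem corollary3 (R : realType) (c : R) (a b : nat -> R) (F : R -> R)
  (c_gt0 : 0 < c)
  (a_gt0 : forall k, (1 <= k)%N -> 0 < a k)
  (sum_a : (\sum_(1 <= j <oo) ((a j)^-1)%:E < +oo)%E)
  (b_ge0 : forall k, (1 <= k)%N -> 0 <= b k)
  (sum_ba : (\sum_(1 <= j <oo)
               ((b j)%:E * \sum_(j <= i <oo) ((a i)^-1)%:E) < +oo)%E)
  (F_cont : continuous F)
  (F_sign : forall u, u != 0 -> 0 < F u * u)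
  (F_lim0 : cvg (F u / u @[u --> 0^'+]))
  (bound : exists2 lambda : R, 0 < lambda &
     forall k, (1 <= k)%N ->
       4 * lambda * (k.+1%:R) ^+ 2 <= a k /\
       Num.sqrt (1 + c ^+ 2) * sup_ratio F c * b k <= lambda) :
  exists x : nat -> R, bvp_solution a b F c x.
Proof.
case: bound => lambda lambda_gt0 bound.
pose step n w := trunc_slope c (w / a n.+1).
pose load n u := b n.+1 * Num.max (F u) 0.
pose K := Num.sqrt (1 + c ^+ 2).
have K_gt0 : 0 < K := lt_le_trans ltr01 (sqrt1D_ge1 R c).
have load_ge0 n u : 0 <= load n u by rewrite mulr_ge0 ?b_ge0 // le_max lexx orbT.
have step0 n : step n 0 = 0 by rewrite /step mul0r trunc_slope0.
have step_gt0 n w : 0 < w -> 0 < step n w.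
  by move=> w_gt0; rewrite trunc_slope_gt0 // divr_gt0 ?a_gt0.
have step_ge0 n w : 0 <= w -> 0 <= step n w.
  by rewrite le_eqVlt => /predU1P[<-|/step_gt0/ltW//]; rewrite step0.
have step_le n w : 0 <= w -> step n w <= K * (w / a n.+1).
  by move=> w_ge0; apply: trunc_slope_le; rewrite divr_ge0 // ltW ?a_gt0.
have step_cont n : continuous (step n).
  move=> w; rewrite /step; apply: (@continuous_comp R R R (fun w => w / a n.+1) (trunc_slope c)).
    by apply: cvgM; [exact: cvg_id | exact: cvg_cst].
  exact: trunc_slope_continuous.
have load_cont n : continuous (load n).
  move=> u; apply: cvgM; first exact: cvg_cst.
  by apply: (@continuous_max R R F (fun=> 0)); [exact: F_cont | exact: cvg_cst].
have load_le n u : 0 < u <= c -> K * load n u <= lambda * u.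
  move=> u_in; have /andP[u_gt0 _] := u_in.
  have F_gt0 : 0 < F u by rewrite -(pmulr_lgt0 _ u_gt0) F_sign // gt_eqF.
  rewrite /load (max_l (ltW F_gt0)).
  have F_le : F u <= sup_ratio F c * u.
    by rewrite -ler_pdivrMr //; exact: ratio_le_sup.
  have [_ bnd] := bound n.+1 isT.
  have : K * sup_ratio F c * b n.+1 * u <= lambda * u.
    by apply: ler_wpM2r bnd; exact: ltW.
  apply: le_trans.
  rewrite -!mulrA ler_wpM2l ?(ltW K_gt0) // mulrCA.
  by rewrite ler_wpM2l ?b_ge0.
have x0_gt0 n : 0 < (shoot step load c 0 n).1.
  apply: (proj1 (riccati_invariant R step load (fun n => a n.+1) c 0 K lambda
    c_gt0 _ lambda_gt0 K_gt0 step_ge0 load_ge0 step_le _ load_le _ n)) => //.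
    by move=> m; case: (bound m.+1).
  by rewrite mulr0 !mulr_ge0 // ltW.
pose s1 := a 1%N * (c + 1).
have s1_ge0 : 0 <= s1 by rewrite mulr_ge0 ?(ltW (a_gt0 _ _)) //; lra.
(* As s1 / a_1 = c + 1, the first drop is at least c + 1. *)
have x1_lt0 : (shoot step load c s1 1).1 < 0.
  rewrite /= /step /s1 mulrC mulKf ?gt_eqF ?a_gt0 //.
  have := trunc_slope_ge R c (c + 1); lra.
pose M := `|F 0| + sup_ratio F c * c.
have M_ub u : u <= c -> Num.max (F u) 0 <= M by exact: pos_part_bounded.
have M_ge0 : 0 <= M by apply: le_trans (M_ub c (lexx _)); rewrite le_max lexx orbT.
have tail S : exists2 E : nat -> R, cvgn (series E) &
    forall s n, 0 <= s <= S -> step n (shoot step load c s n).2 <= E n.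
  exists (fun n => (K * `|S| + K * M * \sum_(1 <= j < n.+1) b j) / a n.+1).
    by apply: flux_bound_summable; rewrite // mulr_ge0 // ltW.
  move=> s n /andP[s_ge0 /le_trans/(_ (ler_norm S)) s_leS].
  have x_le m : (shoot step load c s m).1 <= c.
    exact: (shoot_height_homo R step load c s step_ge0 load_ge0 s_ge0 0 m).
  have w_ge0 : 0 <= (shoot step load c s n).2.
    exact: le_trans s_ge0 (shoot_flux_homo R step load c s load_ge0 0 n isT).
  apply: le_trans (step_le n _ w_ge0) _.
  rewrite mulrA ler_wpM2r ?invr_ge0 ?(ltW (a_gt0 _ _)) //.
  rewrite -mulrA -mulrDr ler_wpM2l ?(ltW K_gt0) //.
  elim: n {w_ge0} => [|n IH]; first by rewrite big_geq //= mulr0 addr0.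
  rewrite big_nat_recr //= mulrDr addrA lerD // [M * _]mulrC.
  by rewrite ler_wpM2l ?b_ge0 // M_ub // (x_le n.+1).
have [s s_ge0 [x_gt0 x_lim]] := shooting_principle R step load c s1 1 c_gt0
  s1_ge0 step_cont load_cont load_ge0 step0 step_gt0 (fun n => ltW (x0_gt0 n))
  x1_lt0 tail.
exists (fun k => (shoot step load c s k.-1).1).
exact: shoot_bvp_solution.
Qed.
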